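(* Let $\bm{\theta}\in\mathbb{R}^n$ be the true value of an unknown parameter and let the Fisher information matrix $\bm{J}$ at $\bm{\theta}$ be singular with rank $r$. Let $$\bm{J}=\begin{bmatrix}\bm{U}_r & \overline{\bm{U}}_r\end{bmatrix}\begin{bmatrix}\bm{\Sigma}&\bm{0}\\ \bm{0}&\bm{0}\end{bmatrix}\begin{bmatrix}\bm{U}_r^T\\ \overline{\bm{U}}_r^T\end{bmatrix}$$ be a singular value decomposition of $\bm{J}$, where $[\bm{U}_r\ \overline{\bm{U}}_r]$ is a real orthogonal $n\times n$ matrix, $\bm{U}_r$ is $n\times r$, and $\bm{\Sigma}$ is an $r\times r$ diagonal matrix with nonzero diagonal entries. Then $\bm{J}^{\dagger}$ is a Cramér-Rao bound for constrained parameters: for some constant vector $\bm{C}\in\mathbb{R}^{n-r}$, the constraint $$\bm{f}(\bm{\theta})=\overline{\bm{U}}_r^T\bm{\theta}+\bm{C}=\bm{0}$$ is satisfied at the true parameter value, and the constrained Cramér-Rao bound of the constraint function $\bm{f}(\bm{x})=\overline{\bm{U}}_r^T\bm{x}+\bm{C}$ exists and equals $\bm{J}^{\dagger}$.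
   Context: $\bm{M}^{\dagger}$ denotes the Moore-Penrose generalized inverse. The observation $\bm{y}$ has probability density function $p(\bm{y};\bm{\theta})$, and the Fisher information matrix is $\bm{J}=\mathsf{E}\left[\frac{\partial\ln p}{\partial\bm{\theta}}\frac{\partial\ln p}{\partial\bm{\theta}^T}\right]$, an $n\times n$ real symmetric nonnegative definite matrix. Everything is considered at a fixed parameter value $\bm{\theta}$, and $\partial\bm{f}/\partial\bm{\theta}^T$ is the Jacobian of $\bm{f}$ at $\bm{\theta}$. Constrained Cramér-Rao bound: let $\bm{f}:\mathbb{R}^n\to\mathbb{R}^m$, $m\le n$, be a differentiable constraint function (the parameter is required to satisfy $\bm{f}(\bm{\theta})=\bm{0}$) with $\partial\bm{f}/\partial\bm{\theta}^T$ of full rank $m$. Let $\bm{U}$ be an $n\times(n-m)$ matrix with orthonormal columns such that $\frac{\partial\bm{f}}{\partial\bm{\theta}^T}\bm{U}=\bm{0}$. The constrained Cramér-Rao bound of $\bm{f}$ exists if $\bm{U}^T\bm{J}\bm{U}$ is nonsingular, and is then the matrix $\bm{U}(\bm{U}^T\bm{J}\bm{U})^{-1}\bm{U}^T$ (independent of the choice of $\bm{U}$; if $m=n$, $\bm{U}$ has no columns, the $0\times 0$ matrix counts as nonsingular, and the bound is the zero matrix). *)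

(* Defs.v *)
From mathcomp Require Import all_boot all_order all_algebra.
From mathcomp Require Import all_classical all_reals all_analysis.
Set Implicit Arguments.
Unset Strict Implicit.
Unset Printing Implicit Defensive.
Import Order.TTheory GRing.Theory Num.Theory.
Import numFieldNormedType.Exports.
Local Open Scope classical_set_scope.
Local Open Scope ring_scope.

(* The four Penrose equations. MathComp's [pinvmx] is only a generalized
   inverse: it satisfies the first equation but in general not the last two. *)
Definition is_moore_penrose (R : realType) (m n : nat)
    (A : 'M[R]_(m, n)) (X : 'M[R]_(n, m)) : Prop :=
  [/\ A *m X *m A = A, X *m A *m X = X,
      (A *m X)^T = A *m X & (X *m A)^T = X *m A].

(* Exactly one matrix satisfies the four equations ([mpinvP] and
   [mpinv_unique]), so the default value of [xget] plays no role. *)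
Definition mpinv (R : realType) (m n : nat) (A : 'M[R]_(m, n)) :
    'M[R]_(n, m) :=
  xget 0 [set X | is_moore_penrose A X].

Lemma gram_unitmx (R : realType) (m n : nat) (B : 'M[R]_(m, n)) :
  row_free B -> B *m B^T \in unitmx.
Proof.
move=> Bfree; rewrite -row_free_unit -kermx_eq0; apply/eqP/row_matrixP => i.
rewrite row0; set v := row i _.
have vBB : v *m (B *m B^T) = 0.
  by apply/sub_kermxP; exact: row_sub.
have : v *m B *m (v *m B)^T = 0 by rewrite trmx_mul mulmxA -(mulmxA v) vBB mul0mx.
move=> /matrixP /(_ 0 0); rewrite [LHS]mxE [RHS]mxE => /eqP.
rewrite psumr_eq0 => [/allP vB0|j _]; last first.
  by rewrite [X in _ * X]mxE -expr2 sqr_ge0.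
apply: (row_free_inj Bfree); rewrite mul0mx; apply/rowP => j.
have := vB0 j (mem_index_enum _); rewrite [X in _ * X]mxE -expr2 sqrf_eq0.
by move=> /eqP ->; rewrite mxE.
Qed.

Lemma moore_penrose_mul (R : realType) (m k n : nat)
    (C : 'M[R]_(m, k)) (B : 'M[R]_(k, n)) :
  row_free C^T -> row_free B ->
  is_moore_penrose (C *m B)
    (B^T *m invmx (B *m B^T) *m invmx (C^T *m C) *m C^T).
Proof.
move=> /gram_unitmx; rewrite trmxK => GC /gram_unitmx GB; set X := (X in is_moore_penrose _ X).
have AX : C *m B *m X = C *m invmx (C^T *m C) *m C^T.
  by rewrite /X !mulmxA -(mulmxA C B) -(mulmxA C) mulmxV // mulmx1.
have XA : X *m (C *m B) = B^T *m invmx (B *m B^T) *m B.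
  rewrite /X !mulmxA -(mulmxA _ C^T C) -(mulmxA _ (invmx (C^T *m C))).
  by rewrite mulVmx // mulmx1.
split.
- rewrite AX !mulmxA -(mulmxA _ C^T C) -(mulmxA C) mulVmx //.
  by rewrite mulmx1.
- rewrite XA {1}/X !mulmxA -(mulmxA _ B B^T) -(mulmxA B^T (invmx _)).
  by rewrite mulVmx // mulmx1.
- by rewrite AX !trmx_mul trmxK trmx_inv trmx_mul trmxK mulmxA.
- by rewrite XA !trmx_mul trmxK trmx_inv trmx_mul trmxK mulmxA.
Qed.

Lemma mpinvP (R : realType) (m n : nat) (A : 'M[R]_(m, n)) :
  is_moore_penrose A (mpinv A).
Proof.
rewrite /mpinv; case: xgetP => [X _ //|noX]; exfalso.
have Cfree : row_free (col_base A)^T.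
  by rewrite /row_free mxrank_tr; exact: col_base_full.
have := moore_penrose_mul Cfree (row_base_free A).
by rewrite mulmx_base; exact: noX.
Qed.

Lemma mpinv_unique (R : realType) (m n : nat) (A : 'M[R]_(m, n)) X Y :
  is_moore_penrose A X -> is_moore_penrose A Y -> X = Y.
Proof.
move=> [AXA XAX AXs XAs] [AYA YAY AYs YAs].
have AXY : A *m X = A *m Y.
  rewrite -AYs -[in RHS]AXA -[in RHS]mulmxA trmx_mul AYs AXs mulmxA.
  by rewrite AYA.
have XAY : X *m A = Y *m A.
  have YAE : Y *m A *m (X *m A) = Y *m A.
    by rewrite mulmxA -!mulmxA (mulmxA A) AXA.
  by rewrite -YAs -YAE trmx_mul YAs XAs -mulmxA (mulmxA A) AYA.
by rewrite -XAX -mulmxA AXY mulmxA XAY YAY.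
Qed.

Definition is_density (R : realType) (d : measure_display)
    (T : measurableType d) (mu : {measure set T -> \bar R}) (q : T -> R) : Prop :=
  [/\ measurable_fun setT q, forall y, 0 <= q y &
      (\int[mu]_y (q y)%:E = 1)%E].

(* The j-th entry of the score vector, i.e. the derivative of
   ln p(y; theta) with respect to the j-th coordinate of theta. *)
Definition score (R : realType) (T : Type) (n : nat)
    (p : T -> 'cV[R]_n -> R) (theta : 'cV[R]_n) (y : T) (j : 'I_n) : R :=
  'D_(delta_mx j 0) (fun t : 'cV[R]_n => ln (p y t)) theta.

(* Expectation is with respect to the law p(.; theta) dmu of the observation.
   Where p(y; theta) = 0 the value of [ln], hence of [score], is irrelevant. *)
Definition fisher_information (R : realType) (d : measure_display)
    (T : measurableType d) (mu : {measure set T -> \bar R}) (n : nat)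
    (p : T -> 'cV[R]_n -> R) (theta : 'cV[R]_n) : 'M[R]_n :=
  \matrix_(i, j)
    Rintegral mu setT (fun y => score p theta y i * score p theta y j * p y theta).

(* The conditions under which [fisher_information] is meaningful: otherwise
   derivatives and integrals take default values. *)
Definition fisher_well_defined (R : realType) (d : measure_display)
    (T : measurableType d) (mu : {measure set T -> \bar R}) (n : nat)
    (p : T -> 'cV[R]_n -> R) (theta : 'cV[R]_n) : Prop :=
  [/\ \forall t \near theta, is_density mu (p ^~ t),
      {ae mu, forall y, 0 < p y theta ->
         forall j : 'I_n,
           derivable (fun t : 'cV[R]_n => ln (p y t)) theta (delta_mx j 0)} &
      forall i j : 'I_n, mu.-integrable setT
        (fun y => (score p theta y i * score p theta y j * p y theta)%:E)].

(* The library's [jacobian] is for functions between row vectors and is the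
   transpose of the matrix below. *)
Definition jacobian_mx (R : realType) (n m : nat)
    (f : 'cV[R]_n -> 'cV[R]_m) (theta : 'cV[R]_n) : 'M[R]_(m, n) :=
  \matrix_(i, j) ('D_(delta_mx j 0) f theta) i 0.

Definition constraint_at (R : realType) (n m : nat)
    (f : 'cV[R]_n -> 'cV[R]_m) (theta : 'cV[R]_n) : Prop :=
  [/\ (m <= n)%N, forall x, differentiable f x, f theta = 0 &
      \rank (jacobian_mx f theta) = m].

Definition orthonormal_null_basis (R : realType) (n m : nat)
    (f : 'cV[R]_n -> 'cV[R]_m) (theta : 'cV[R]_n)
    (U : 'M[R]_(n, n - m)) : Prop :=
  U^T *m U = 1%:M /\ jacobian_mx f theta *m U = 0.

(* "The constrained Cramer-Rao bound of f at theta exists and is equal to B".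
   Independence of the choice of U is part of the definition; 0 x 0 matrices
   are in [unitmx], so that B = 0 when m = n. *)
Definition is_constrained_crb (R : realType) (n m : nat) (J : 'M[R]_n)
    (f : 'cV[R]_n -> 'cV[R]_m) (theta : 'cV[R]_n) (B : 'M[R]_n) : Prop :=
  [/\ constraint_at f theta,
      exists U, orthonormal_null_basis f theta U &
      forall U, orthonormal_null_basis f theta U ->
        U^T *m J *m U \in unitmx /\
        B = U *m invmx (U^T *m J *m U) *m U^T].

(* Main.v *)
Require Import Defs.
From mathcomp Require Import all_boot all_order all_algebra.
From mathcomp Require Import all_classical all_reals all_analysis.
Set Implicit Arguments.
Unset Strict Implicit.
Unset Printing Implicit Defensive.
Import Order.TTheory GRing.Theory Num.Theory.
Import numFieldNormedType.Exports.
Local Open Scope classical_set_scope.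
Local Open Scope ring_scope.

(** The constraint fixes the components of the parameter along the null space of [J], so the
    feasible directions form the range of [Ur], on which [J] acts invertibly as [Sigma]. Any
    admissible [U] is an orthonormal basis of that range, hence [Ur] times an orthogonal matrix, and
    this factor cancels in the bound ([crb_change_basis]), leaving [Ur *m invmx Sigma *m Ur^T]. That
    matrix is also the Moore-Penrose inverse of [J] ([mpinv_conj_unitmx]). *)

Lemma mulmx_col_differentiable (R : realType) (m n : nat) (A : 'M[R]_(m, n))
    (x : 'cV[R]_n) :
  differentiable (mulmx A : 'cV[R]_n -> 'cV[R]_m) x.
Proof.
have -> : (mulmx A : 'cV[R]_n -> 'cV[R]_m) =
    \sum_(j < n) (fun x : 'cV[R]_n => x j 0 *: col j A).
  apply/funext => y; rewrite fct_sumE; apply/colP => i.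
  by rewrite summxE mxE; apply: eq_bigr => j _; rewrite !mxE mulrC.
apply: differentiable_sum => j; apply: differentiableZl.
exact: differentiable_coord.
Qed.

Lemma affine_differentiable (R : realType) (m n : nat) (A : 'M[R]_(m, n))
    (c : 'cV[R]_m) (x : 'cV[R]_n) :
  differentiable (fun y : 'cV[R]_n => A *m y + c) x.
Proof.
apply: differentiableD; last exact: differentiable_cst.
exact: mulmx_col_differentiable.
Qed.

Lemma jacobian_mx_affine (R : realType) (m n : nat) (A : 'M[R]_(m, n))
    (c : 'cV[R]_m) (x : 'cV[R]_n) :
  jacobian_mx (fun y : 'cV[R]_n => A *m y + c) x = A.
Proof.
have dA := mulmx_col_differentiable A.
apply/matrixP => i j; rewrite mxE deriveD; first last.
- exact: derivable_cst.
- exact: diff_derivable.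
(* A continuous linear map is its own differential; at [delta_mx j 0] it returns column [j] of
   [A]. *)
rewrite derive_cst addr0 deriveE // diff_lin; last first.
  by move=> y; exact: differentiable_continuous.
by rewrite /= -colE mxE.
Qed.

Lemma diag_unitmx (F : fieldType) (r : nat) (S : 'M[F]_r) :
  is_diag_mx S -> (forall i, S i i != 0) -> S \in unitmx.
Proof.
move=> /is_diag_mx_is_trig trS nzS.
by rewrite unitmxE det_trig // unitfE; apply/prodf_neq0 => i _.
Qed.

(** Both products of the two matrices collapse to the symmetric projector [V *m V^T], which gives
    the four Penrose equations; uniqueness concludes. *)
Lemma mpinv_conj_unitmx (R : realType) (n r : nat) (V : 'M[R]_(n, r))
    (S : 'M[R]_r) :
  V^T *m V = 1%:M -> S \in unitmx ->
  mpinv (V *m S *m V^T) = V *m invmx S *m V^T.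
Proof.
move=> VV Su; apply: mpinv_unique (mpinvP _) _.
have AX : V *m S *m V^T *m (V *m invmx S *m V^T) = V *m V^T.
  by rewrite !mulmxA -(mulmxA _ V^T V) VV mulmx1 mulmxK.
have XA : V *m invmx S *m V^T *m (V *m S *m V^T) = V *m V^T.
  by rewrite !mulmxA -(mulmxA _ V^T V) VV mulmx1 mulmxKV.
split; rewrite ?AX ?XA ?trmx_mul ?trmxK //.
  by rewrite !mulmxA -(mulmxA V V^T V) VV mulmx1.
by rewrite !mulmxA -(mulmxA V V^T V) VV mulmx1.
Qed.

(* Orthonormal columns annihilated by [W^T] span the range of [V], so that
   [U = V *m Q] for the orthogonal matrix [Q = V^T *m U]. *)
Lemma crb_change_basis (R : realType) (n k r s : nat) (V : 'M[R]_(n, r))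
    (W : 'M[R]_(n, s)) (S : 'M[R]_r) (U : 'M[R]_(n, k)) :
  k = r -> V *m V^T + W *m W^T = 1%:M -> S \in unitmx ->
  U^T *m U = 1%:M -> W^T *m U = 0 ->
  let H := U^T *m (V *m S *m V^T) *m U in
  H \in unitmx /\ U *m invmx H *m U^T = V *m invmx S *m V^T.
Proof.
move=> kr; subst k => VW Su UU WU H; pose Q := V^T *m U.
have UE : U = V *m Q.
  by rewrite -[LHS]mul1mx -VW mulmxDl -!mulmxA WU mulmx0 addr0.
have QQ : Q^T *m Q = 1%:M.
  by rewrite {1}/Q trmx_mul trmxK -mulmxA -UE.
(* [Q] is square because [k = r], so its left inverse is also a right inverse. *)
have QQ' := mulmx1C QQ.
have HE : H = Q^T *m S *m Q by rewrite /H /Q trmx_mul trmxK !mulmxA.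
have [QTu Qu] := mulmx1_unit QQ.
have Hu : H \in unitmx by rewrite HE !unitmx_mul QTu Su Qu.
clearbody H Q; split => //.
have -> : invmx H = Q^T *m invmx S *m Q.
  rewrite -[RHS](mulmxK Hu) HE !mulmxA -(mulmxA _ Q Q^T) QQ' mulmx1.
  by rewrite mulmxKV // QQ mul1mx.
rewrite UE trmx_mul !mulmxA -(mulmxA V Q) QQ' mulmx1.
by rewrite -(mulmxA _ Q Q^T) QQ' mulmx1.
Qed.

Theorem mainTheorem2 (R : realType) (d : measure_display)
    (T : measurableType d) (mu : {measure set T -> \bar R}) (n r : nat)
    (p : T -> 'cV[R]_n -> R) (theta : 'cV[R]_n) (J : 'M[R]_n)
    (p_fisher : fisher_well_defined mu p theta)
    (JE : J = fisher_information mu p theta)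
    (J_singular : J \notin unitmx) (J_rank : \rank J = r)
    (Ur : 'M[R]_(n, r)) (Ub : 'M[R]_(n, n - r)) (Sigma : 'M[R]_r)
    (U_orthogonal : (row_mx Ur Ub)^T *m row_mx Ur Ub = 1%:M /\
                    row_mx Ur Ub *m (row_mx Ur Ub)^T = 1%:M)
    (Sigma_diag : is_diag_mx Sigma)
    (Sigma_neq0 : forall i, Sigma i i != 0)
    (J_svd : J = row_mx Ur Ub *m block_mx Sigma 0 0 0 *m col_mx Ur^T Ub^T) :
  exists C : 'cV[R]_(n - r),
    let f := fun x : 'cV[R]_n => Ub^T *m x + C in
    f theta = 0 /\ is_constrained_crb J f theta (mpinv J).
Proof.
have [] := U_orthogonal.
rewrite tr_row_mx mul_col_row mul_row_col scalar_mx_block => UTU UUT.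
have [UrUr _ UbUr UbUb] := eq_block_mx UTU.
have Su := diag_unitmx Sigma_diag Sigma_neq0.
have JVS : J = Ur *m Sigma *m Ur^T.
  by rewrite J_svd mul_row_block !mulmx0 !addr0 mul_row_col mul0mx addr0.
(* Subtraction on [nat] is truncated: this bound is what makes [n - (n - r)] equal to [r]. *)
have rn : (r <= n)%N by rewrite -J_rank rank_leq_row.
have kr : (n - (n - r))%N = r by rewrite subKn.
exists (- (Ub^T *m theta)) => f.
have f0 : f theta = 0 by rewrite /f subrr.
split => //; split.
- split=> //; first exact: leq_subr.
    by move=> x; exact: affine_differentiable.
  (* Full rank: the identity of size [n - r] factors through [Ub^T]. *)
  rewrite jacobian_mx_affine; apply/eqP; rewrite eqn_leq rank_leq_row /=.
  by rewrite -[X in (X <= _)%N](mxrank1 R) -UbUb mxrankM_maxl.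
(* [Ur] itself is the basis; the cast only adjusts its column count from [r] to [n - (n - r)]. *)
- exists (castmx (erefl n, esym kr) Ur).
  rewrite /orthonormal_null_basis jacobian_mx_affine.
  by case: _ / (esym kr).
- move=> U []; rewrite jacobian_mx_affine => UU UbU.
  have [Hu HE] := crb_change_basis kr UUT Su UU UbU.
  by rewrite JVS HE mpinv_conj_unitmx.
Qed.
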